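(* Let $n\ge2$, $d\ge2$, and let $C=(c_{kl})$ be a real symmetric $n\times n$-matrix with zeros on the diagonal and all off-diagonal entries non-zero. Let $H_C=\sum_{k,l}c_{kl}\,a_ka_l^\dagger$ on $(\mathbb{C}^d)^{\otimes n}$. Then a time optimal scheme for inverting $H_C$ is given by the vectors $$m_k:=(e^{2\pi i k/n},e^{2\pi i 2k/n},\dots,e^{2\pi i (n-1)k/n}),\qquad k=1,\dots,n .$$ That is: 1. (Inversion with overhead $n-1$.) With $W_j:=\prod_{k=1}^n\exp\!\big(i h_k\,2\pi jk/n\big)$ for $j=1,\dots,n-1$, one has $\sum_{j=1}^{n-1}W_jH_CW_j^\dagger=-H_C$. 2. (Optimality.) If $-H_C=\sum_j\tau_jU_j^\dagger H_CU_j$ for finitely many $\tau_j>0$ and local unitaries $U_j=V_{j1}\otimes\cdots\otimes V_{jn}$ with arbitrary $V_{jk}\in SU(d)$, then $\sum_j\tau_j\ge n-1$.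
   Context: Each of the $n$ nodes is a (truncated) harmonic oscillator with Hilbert space $\mathbb{C}^d$ and orthonormal basis $|0\rangle,\dots,|d-1\rangle$. The annihilation operator $a$ on $\mathbb{C}^d$ is defined by $a|0\rangle=0$, $a|E\rangle=\sqrt{E}\,|E-1\rangle$ for $E=1,\dots,d-1$; its adjoint $a^\dagger$ is the creation operator. $a_k$, $a_k^\dagger$ denote these operators acting on the $k$-th tensor factor, and $h_k$ denotes $\mathrm{diag}(0,1,\dots,d-1)$ acting on the $k$-th factor. Vectors $m_1,\dots,m_n\in\mathbb{C}^N$ with entries of modulus one define a scheme of $N$ unit time steps: if $(e^{it_1},\dots,e^{it_n})$ are the $j$-th entries of $m_1,\dots,m_n$, then in the $j$-th step the evolution is conjugated by $W_j=\prod_{k=1}^n\exp(ih_kt_k)$, i.e. $H_C$ is replaced by $W_jH_CW_j^\dagger$; the total simulated Hamiltonian is $\sum_{j=1}^NW_jH_CW_j^\dagger$ and the time overhead is $N$. A scheme is time optimal if its overhead is minimal among all simulations of $-H_C$ of the form $-H_C=\sum_j\tau_jU_j^\dagger H_CU_j$ with $\tau_j>0$ and local unitaries $U_j$, where the overhead is $\sum_j\tau_j$. *)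

(* Defs.v *)
From HB Require Import structures.
From mathcomp Require Import all_boot all_order all_algebra.
From mathcomp Require Import complex.
From mathcomp Require Import all_classical all_reals all_analysis.

Set Implicit Arguments.
Unset Strict Implicit.
Unset Printing Implicit Defensive.

Import Order.TTheory GRing.Theory Num.Theory.
Import numFieldNormedType.Exports.

Local Open Scope ring_scope.
Local Open Scope complex_scope.
Local Open Scope sesquilinear_scope.

Section HarmonicOscillators.
Variable R : realType.

Definition expi (t : R) : R[i] := cos t +i* sin t.

(* The exponential series sum_p A^p / p!, the limit being taken separately on
   the real and imaginary part of each entry. *)
Definition expmx_partial D (A : 'M[R[i]]_D) (N : nat) : 'M[R[i]]_D :=
  \sum_(p < N) (p`!%:R)^-1 *: A ^+ p.

Definition expmx D (A : 'M[R[i]]_D) : 'M[R[i]]_D :=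
  \matrix_(x, y)
    (limn (fun N => complex.Re (expmx_partial A N x y))
     +i* limn (fun N => complex.Im (expmx_partial A N x y))).

Section System.
Variables n d : nat.

(* The basis vector |E_1> (x) ... (x) |E_n> of (C^d)^{(x) n} is the function
   k |-> E_k; operators are matrices acting on column vectors, indexed by
   these functions through enum_val, with A x y = <x|A|y>. *)
Definition config := {ffun 'I_n -> 'I_d}.
Definition operator := 'M[R[i]]_(#|config|).

Definition tensor (V : 'I_n -> 'M[R[i]]_d) : operator :=
  \matrix_(x, y) \prod_k V k ((enum_val x : config) k) ((enum_val y : config) k).

Definition on_node (k : 'I_n) (A : 'M[R[i]]_d) : operator :=
  tensor (fun l => if l == k then A else 1%:M).

(* Column E is a|E> = sqrt E |E-1>. *)
Definition annihilation : 'M[R[i]]_d :=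
  \matrix_(F, E) if (E == F.+1 :> nat) then (Num.sqrt (E%:R : R))%:C else 0.

Definition number_op : 'M[R[i]]_d := diag_mx (\row_E (E%:R : R[i])).

Definition coupling_hamiltonian (c : 'M[R]_n) : operator :=
  \sum_k \sum_l (c k l)%:C *:
    (on_node k annihilation *m (on_node l annihilation)^t*).

Definition phase_unitary (t : 'I_n -> R) : operator :=
  \prod_k expmx ((0 +i* t k) *: on_node k number_op).

(* W_j is defined from angles t_k such that e^{i t_k} is the j-th entry of m_k;
   any choice of the angles is allowed. *)
Definition scheme_step N (m : 'I_n -> 'rV[R[i]]_N) (j : 'I_N) (W : operator) :=
  exists2 t : 'I_n -> R,
    forall k, m k 0 j = expi (t k) & W = phase_unitary t.

Definition inverting_scheme (H : operator) N (m : 'I_n -> 'rV[R[i]]_N) :=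
  (forall k j, `|m k 0 j| = 1) /\
  (forall W : 'I_N -> operator, (forall j, scheme_step m j (W j)) ->
     \sum_j W j *m H *m (W j)^t* = - H).

Definition inverting_simulation (H : operator) s (tau : 'I_s -> R)
    (V : 'I_s -> 'I_n -> 'M[R[i]]_d) :=
  [/\ forall j, 0 < tau j,
      forall j k, V j k \is unitarymx
    & - H = \sum_j (tau j)%:C *: ((tensor (V j))^t* *m H *m tensor (V j))].

Definition time_optimal_inverting_scheme (H : operator) N
    (m : 'I_n -> 'rV[R[i]]_N) :=
  inverting_scheme H m /\
  (forall s (tau : 'I_s -> R) (V : 'I_s -> 'I_n -> 'M[R[i]]_d),
     inverting_simulation H tau V -> N%:R <= \sum_j tau j).

(* Ordinals count from 0: k : 'I_n stands for node k+1 and j for step j+1. *)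
Definition fourier_angle (j : nat) (k : 'I_n) : R :=
  2 * pi * (j * k.+1)%:R / n%:R.

Definition fourier_scheme (k : 'I_n) : 'rV[R[i]]_n.-1 :=
  \row_j expi (fourier_angle j.+1 k).

End System.
End HarmonicOscillators.

(* Main.v *)
Require Import Defs.
From mathcomp Require Import all_boot all_order all_algebra.
From mathcomp Require Import complex.
From mathcomp Require Import all_classical all_reals all_analysis.
From mathcomp Require Import ring lra.
Import Order.TTheory GRing.Theory Num.Theory.
Local Open Scope ring_scope.
Local Open Scope complex_scope.
Local Open Scope sesquilinear_scope.

(** A diagonal phase e^{i t h} turns a into e^{-it} a, so the j-th step multiplies
    the term a_k a_l^* by e^{2 pi i j (l - k) / n}; for k <> l the sum of these
    factors over the nontrivial n-th roots of unity is -1.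

    For the lower bound, pair -H = sum_j tau_j U_j^* H U_j with a_k a_l^* in the
    Hilbert-Schmidt product.  With A_jk = V_jk^* a V_jk, N = |a|^2, x_jk = <a, A_jk>
    and y_jk = <a^*, A_jk>, the factor c_kl cancels and leaves
      sum_j tau_j (x_jk conj x_jl + conj y_jk y_jl) = - N^2     for all k <> l.
    Now sum over k <> l: for each j the double sum equals
    |sum_k x_jk|^2 + |sum_k y_jk|^2 - sum_k (|x_jk|^2 + |y_jk|^2), which is at
    least - n N^2 by Bessel's inequality for the orthogonal pair a, a^*.  Hence
    n (n - 1) N^2 <= n N^2 sum_j tau_j. *)

(** * Adjoints, traces and two inequalities for the lower bound *)

Lemma adjmxM (C : numClosedFieldType) m n p (A : 'M[C]_(m, n)) (B : 'M[C]_(n, p)) :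
  (A *m B)^t* = B^t* *m A^t*.
Proof. by rewrite trmx_mul map_mxM. Qed.

Lemma adjmx1 (C : numClosedFieldType) m : (1%:M : 'M[C]_m)^t* = 1%:M.
Proof. by rewrite trmx1 map_mx1. Qed.

Lemma mxtrace_adj (C : numClosedFieldType) m (A : 'M[C]_m) : \tr (A^t*) = (\tr A)^*%R.
Proof. by rewrite trace_map_mx mxtrace_tr. Qed.

Lemma conj_mxtrace_mul (C : numClosedFieldType) m (A B : 'M[C]_m) :
  (\tr (A *m B))^*%R = \tr (A^t* *m B^t*).
Proof. by rewrite -mxtrace_adj adjmxM mxtrace_mulC. Qed.

Lemma mxtrace_adjM_ge0 (C : numClosedFieldType) m (Z : 'M[C]_m) : 0 <= \tr (Z^t* *m Z).
Proof.
apply: sumr_ge0 => i _; rewrite mxE; apply: sumr_ge0 => j _.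
by rewrite !mxE /= mulrC mul_conjC_ge0.
Qed.

(* [\tr (A *m A) = 0] says that [A] and [A^t*] are orthogonal in the
   Hilbert-Schmidt product. *)
Lemma bessel_adj_pair (C : numClosedFieldType) m (A B : 'M[C]_m) :
    \tr (A *m A) = 0 -> \tr (B^t* *m B) = \tr (A^t* *m A) -> 0 < \tr (A^t* *m A) ->
  `|\tr (A^t* *m B)| ^+ 2 + `|\tr (A *m B)| ^+ 2 <= \tr (A^t* *m A) ^+ 2.
Proof.
set N := \tr (A^t* *m A); set x := \tr (A^t* *m B); set y := \tr (A *m B).
(* [Z] is [N] times the component of [B] orthogonal to [A] and its adjoint; the factor [N] avoids
   division. The claim is the positivity of its squared norm. *)
move=> AA BB N_gt0; pose Z := N *: B - x *: A - y *: A^t*.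
have NJ : N^*%R = N by apply/CrealP/gtr0_real.
have trBA : \tr (B^t* *m A) = x^*%R by rewrite conj_mxtrace_mul trmxCK mxtrace_mulC.
have trBA' : \tr (B^t* *m A^t*) = y^*%R by rewrite conj_mxtrace_mul mxtrace_mulC.
have AA' : \tr (A^t* *m A^t*) = 0 by rewrite -conj_mxtrace_mul AA conjC0.
have ZE : \tr (Z^t* *m Z) = N * (N ^+ 2 - (`|x| ^+ 2 + `|y| ^+ 2)).
  have trZl (P Q S M : 'M[C]_m) u v w :
      \tr ((u *: P - v *: Q - w *: S) *m M) =
      u * \tr (P *m M) - v * \tr (Q *m M) - w * \tr (S *m M).
    by rewrite !mulmxBl -!scalemxAl !raddfB /= !mxtraceZ.
  have -> : Z^t* = N *: B^t* - x^*%R *: A^t* - y^*%R *: A.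
    by apply/matrixP => i j; rewrite !mxE /= !(rmorphB, rmorphM) /= conjCK NJ.
  rewrite trZl ![\tr (_ *m Z)]mxtrace_mulC /Z !trZl.
  rewrite ![\tr (B *m _)]mxtrace_mulC ![\tr (A *m _^t*)]mxtrace_mulC.
  rewrite [\tr (A^t* *m B^t*)]mxtrace_mulC.
  rewrite BB trBA trBA' AA AA' -/N -/x -/y !normCK.
  ring.
have := mxtrace_adjM_ge0 _ _ Z.
by rewrite ZE pmulr_rge0 // subr_ge0.
Qed.

Lemma sum_offdiag_ge (C : numClosedFieldType) n (x y : 'I_n -> C) M :
    (forall k, `|x k| ^+ 2 + `|y k| ^+ 2 <= M) ->
  - (n%:R * M) <= \sum_k \sum_(l | k != l) (x k * (x l)^*%R + (y k)^*%R * y l).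
Proof.
move=> le_M.
have -> : \sum_k \sum_(l | k != l) (x k * (x l)^*%R + (y k)^*%R * y l) =
    `|\sum_k x k| ^+ 2 + `|\sum_k y k| ^+ 2 - \sum_k (`|x k| ^+ 2 + `|y k| ^+ 2).
  rewrite !normCK [(\sum_k y k) * _]mulrC !rmorph_sum /= !mulr_suml -big_split /=.
  rewrite -sumrB; apply: eq_bigr => k _.
  rewrite !mulr_sumr -big_split /= [in RHS](bigD1 k) //= !normCK [y k * _]mulrC [RHS]addrC addKr.
  by apply: eq_bigl => l; rewrite eq_sym.
rewrite -[leLHS]add0r lerD ?addr_ge0 ?exprn_ge0 // lerN2.
apply: le_trans (ler_sum _ (fun k _ => le_M k)) _.
by rewrite sumr_const card_ord mulr_natl.
Qed.

(** * Tensor products of local matrices *)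

Section Tensor.
Variables (R : realType) (n d : nat).
Implicit Types V W : 'I_n -> 'M[R[i]]_d.

Lemma eq_tensor V W : V =1 W -> tensor V = tensor W.
Proof.
by move=> eVW; apply/matrixP => x y; rewrite !mxE; apply: eq_bigr => k _; rewrite eVW.
Qed.

Lemma tensorM V W : tensor V *m tensor W = tensor (fun k => V k *m W k).
Proof.
apply/matrixP => x y; rewrite !mxE.
under [RHS]eq_bigr do rewrite mxE.
(* Expanding the product of local sums gives one term per configuration, and [enum_val] matches
   configurations with matrix indices. *)
rewrite bigA_distr_bigA /= [RHS](reindex _ (onW_bij _ (enum_val_bij _))) /=.
by apply: eq_bigr => z _; rewrite !mxE -big_split.
Qed.

Lemma config_neq (x y : 'I_#|config n d|) : x != y ->
  exists k, (enum_val x : config n d) k != (enum_val y : config n d) k.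
Proof.
move=> neq_xy; apply/existsP; apply: contraR neq_xy => /existsPn exy.
by apply/eqP/enum_val_inj/ffunP => k; apply/eqP/negPn/exy.
Qed.

Lemma tensor1 : tensor (fun=> 1%:M) = 1%:M :> operator R n d.
Proof.
apply/matrixP => x y; rewrite !mxE.
under eq_bigr do rewrite mxE.
have [->|neq_xy] := eqVneq x y; first by rewrite big1 // => k _; rewrite eqxx.
have [k neq_k] := config_neq _ _ neq_xy.
by rewrite (bigD1 k) //= (negPf neq_k) mul0r.
Qed.

Lemma tensor_adj V : (tensor V)^t* = tensor (fun k => (V k)^t*).
Proof.
apply/matrixP => x y; rewrite !mxE rmorph_prod.
by apply: eq_bigr => k _; rewrite !mxE.
Qed.

Lemma mxtrace_tensor V : \tr (tensor V) = \prod_k \tr (V k).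
Proof.
rewrite bigA_distr_bigA /= [RHS](reindex _ (onW_bij _ (enum_val_bij _))) /=.
by apply: eq_bigr => z _; rewrite mxE.
Qed.

Lemma on_node_adj (k : 'I_n) (A : 'M[R[i]]_d) : (on_node k A)^t* = on_node k (A^t*).
Proof.
by rewrite tensor_adj; apply: eq_tensor => l; case: eqP => // _; exact: adjmx1.
Qed.

Lemma on_nodeZ (k : 'I_n) (A : 'M[R[i]]_d) z : on_node k (z *: A) = z *: on_node k A.
Proof.
apply/matrixP => x y; rewrite !mxE (bigD1 k) //= [in RHS](bigD1 k) //= eqxx mxE -!mulrA.
by do 2 congr (_ * _); apply: eq_bigr => l /negPf ->.
Qed.

Lemma on_node_conj V (k : 'I_n) (A : 'M[R[i]]_d) :
    (forall l, V l \is unitarymx) ->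
  (tensor V)^t* *m on_node k A *m tensor V = on_node k ((V k)^t* *m A *m V k).
Proof.
move=> uV; rewrite tensor_adj !tensorM; apply: eq_tensor => l.
case: eqP => [-> //|_]; rewrite mulmx1.
by have := uV l; rewrite -trmxC_unitary => /unitarymxP; rewrite trmxCK.
Qed.

Lemma tensor_unitary V : (forall k, V k \is unitarymx) -> tensor V \is unitarymx.
Proof.
move=> uV; apply/unitarymxP; rewrite tensor_adj tensorM -tensor1.
by apply: eq_tensor => k; exact/unitarymxP.
Qed.

Lemma prod_on_node V : \prod_k on_node k (V k) = tensor V.
Proof.
(* Induction needs arbitrary lists of nodes; without repetitions, the node at the head still carries
   the identity in the tail's product. *)
suff Hs (s : seq 'I_n) : uniq s ->
    \prod_(k <- s) on_node k (V k) = tensor (fun l => if l \in s then V l else 1%:M).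
  by rewrite Hs ?index_enum_uniq //; apply: eq_tensor => k; rewrite mem_index_enum.
elim: s => [|k s IHs] /=; first by rewrite big_nil; symmetry; exact: tensor1.
case/andP=> kNs us; rewrite big_cons IHs // -mulmxE tensorM; apply: eq_tensor => l.
rewrite inE; have [->|_] := eqVneq; first by rewrite (negPf kNs) mulmx1.
by rewrite mul1mx.
Qed.

End Tensor.

(** * Complex phases and the exponential of a diagonal matrix *)

Section Phases.
Variable R : realType.
Implicit Types t u : R.

Lemma expi0 : expi 0 = 1 :> R[i].
Proof. by rewrite /expi cos0 sin0. Qed.

Lemma expiD t u : expi (t + u) = expi t * expi u.
Proof. by rewrite /expi cosD sinD; simpc; rewrite [_ + cos t * _]addrC. Qed.

Lemma expiMn t m : expi (t *+ m) = expi t ^+ m.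
Proof. by elim: m => [|m IHm]; rewrite ?expi0 // mulrS expiD IHm exprS. Qed.

Lemma conj_expi t : (expi t)^*%R = expi (- t).
Proof. by rewrite /expi cosN sinN. Qed.

Lemma expi_mul_conj t : expi t * (expi t)^*%R = 1.
Proof. by rewrite conj_expi -expiD subrr expi0. Qed.

Lemma norm_expi t : `|expi t| = 1.
Proof. by apply/eqP; rewrite -sqrp_eq1 // normCK expi_mul_conj. Qed.

Lemma expi_2pi : expi (2 * pi) = 1 :> R[i].
Proof. by rewrite /expi mulr_natl cos2pi sin2pi. Qed.

Lemma expi_neq1 t : 0 < t < 2 * pi -> expi t != 1.
Proof.
case/andP=> t_gt0 t_lt; apply/eqP => -[cos_t _].
have s_gt0 : 0 < sin (t / 2) by apply: sin_gt0_pi; rewrite divr_gt0 // ltr_pdivrMr // mulrC.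
(* The half angle lies strictly between 0 and [pi], so its sine is positive and [cos t] falls short
   of 1. *)
have : cos t = 1 - (sin (t / 2) ^+ 2) *+ 2.
  by rewrite [in LHS](splitr t) -mulr2n cos_mulr2n cos2sin2 mulrnBl opprD; ring.
by have := exprn_gt0 2 s_gt0; rewrite cos_t; lra.
Qed.

(** Powers of a diagonal matrix are diagonal, and even and odd powers of ['i] separate the real from
    the imaginary part. The partial sums on the diagonal are therefore those of the series defining
    [cos] and [sin]. *)
Lemma expmx_diag D t (f : 'I_D -> R) :
  expmx ((0 +i* t) *: diag_mx (\row_x (f x)%:C)) = diag_mx (\row_x expi (t * f x)).
Proof.
have powE p : ((0 +i* t) *: diag_mx (\row_x (f x)%:C)) ^+ p =
    diag_mx (\row_x (0 +i* (t * f x)) ^+ p).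
  elim: p => [|p IHp]; apply/matrixP => x y.
    by rewrite expr0 !mxE.
  rewrite exprS IHp -mulmxE -scalemxAl mulmx_diag !mxE exprS mulrnAr.
  by case: eqP => // _; rewrite ?mulr0n ?mulr1n mulrA; congr (_ * _); simpc.
have coefE u p : (p`!%:R : R[i])^-1 * (0 +i* u) ^+ p =
    cos_coeff u p +i* sin_coeff u p.
  have -> : 0 +i* u = 'i * u%:C by simpc.
  have -> : (p`!%:R : R[i])^-1 = (p`!%:R^-1)%:C by rewrite fmorphV rmorph_nat.
  rewrite exprMn -rmorphXn /= -[in 'i ^+ p](odd_double_half p) exprD -mul2n exprM sqr_i.
  have -> : (-1) ^+ p./2 = ((-1) ^+ p./2)%:C :> R[i] by rewrite rmorphXn rmorphN1.
  rewrite /cos_coeff /sin_coeff /= -!exprnP.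
  case: (boolP (odd p)) => [odd_p|_]; rewrite ?expr1 ?expr0; simpc; congr (_ +i* _); try ring.
  have -> : p.-1./2 = p./2 by rewrite -[in LHS](odd_double_half p) odd_p /= doubleK.
  by ring.
apply/matrixP => x y; rewrite !mxE.
have entryE N : expmx_partial ((0 +i* t) *: diag_mx (\row_x (f x)%:C)) N x y =
   (series (cos_coeff (t * f x)) N +i* series (sin_coeff (t * f x)) N) *+ (x == y).
  rewrite /expmx_partial summxE /series /= !big_mkord.
  rewrite (eq_bigr (fun p : 'I_N => (cos_coeff (t * f x) p +i* sin_coeff (t * f x) p) *+ (x == y))).
    rewrite sumrMnl; congr (_ *+ _).
    by elim/big_rec3: _ => //= p a b c _ ->; simpc.
  by move=> p _; rewrite powE !mxE mulrnAr coefE.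
have [eq_xy|neq_xy] := eqVneq x y.
  rewrite mulr1n /expi cos.unlock sin.unlock.
  congr (_ +i* _).
    rewrite (_ : (fun N => complex.Re _) = series (cos_coeff (t * f x))) //.
    by apply/funext => N; rewrite entryE eq_xy eqxx mulr1n.
  rewrite (_ : (fun N => complex.Im _) = series (sin_coeff (t * f x))) //.
  by apply/funext => N; rewrite entryE eq_xy eqxx mulr1n.
(* Off the diagonal every partial sum vanishes, so both limits are those of the zero sequence. *)
rewrite mulr0n; congr (_ +i* _).
  rewrite (_ : (fun N => complex.Re _) = fun=> 0); first exact: (lim_cst (@norm_hausdorff _ _)).
  by apply/funext => N; rewrite entryE (negPf neq_xy) mulr0n.
rewrite (_ : (fun N => complex.Im _) = fun=> 0); first exact: (lim_cst (@norm_hausdorff _ _)).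
by apply/funext => N; rewrite entryE (negPf neq_xy) mulr0n.
Qed.

End Phases.

(** * The Fourier scheme inverts the Hamiltonian *)

Section Scheme.
Variables (R : realType) (n d : nat).
Local Notation a := (annihilation R d).

(** The shape that the Hamiltonian takes under conjugation by local unitaries; the constant family
    [a] gives back the Hamiltonian itself. *)
Definition coupling_conj (c : 'M[R]_n) (A : 'I_n -> 'M[R[i]]_d) : operator R n d :=
  \sum_k \sum_l (c k l)%:C *: (on_node k (A k) *m (on_node l (A l))^t*).

Lemma conj_coupling_hamiltonian (c : 'M[R]_n) (V : 'I_n -> 'M[R[i]]_d) :
    (forall k, V k \is unitarymx) ->
  (tensor V)^t* *m coupling_hamiltonian d c *m tensor V =
  coupling_conj c (fun k => (V k)^t* *m a *m V k).
Proof.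
move=> uV; rewrite mulmx_sumr mulmx_suml; apply: eq_bigr => k _.
rewrite mulmx_sumr mulmx_suml; apply: eq_bigr => l _.
rewrite -scalemxAr -scalemxAl; congr (_ *: _).
(* Both local factors are written as conjugates by the whole tensor product, whose inner copies then
   cancel. *)
rewrite -!on_node_conj // !adjmxM trmxCK !mulmxA -[_ *m tensor V *m _]mulmxA.
have /unitarymxP -> := tensor_unitary _ _ _ _ uV.
by rewrite mulmx1.
Qed.

Definition phase_mx (t : R) : 'M[R[i]]_d := diag_mx (\row_E expi (t * E%:R)).

Lemma phase_mx_adj t : (phase_mx t)^t* = phase_mx (- t).
Proof.
rewrite tr_diag_mx map_diag_mx; congr diag_mx; apply/rowP => E.
by rewrite !mxE /= conj_expi mulNr.
Qed.

Lemma phase_mx_unitary t : phase_mx t \is unitarymx.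
Proof.
apply/unitarymxP; rewrite phase_mx_adj mulmx_diag -diag_const_mx; congr diag_mx.
by apply/rowP => E; rewrite !mxE -expiD mulNr subrr expi0.
Qed.

(** The non-zero entries of [a] have column index one above the row index, so the two diagonal
    phases always combine to [expi (- t)]. *)
Lemma phase_mx_conj_annihilation t :
  phase_mx t *m a *m (phase_mx t)^t* = expi (- t) *: a.
Proof.
rewrite phase_mx_adj mul_diag_mx mul_mx_diag; apply/matrixP => F E; rewrite !mxE.
case: eqP => [->|_]; last by rewrite !(mulr0, mul0r).
rewrite mulrAC -expiD; congr (expi _ * _).
by rewrite -natr1; ring.
Qed.

Lemma on_node_diag (k : 'I_n) (v : 'rV[R[i]]_d) :
  on_node k (diag_mx v) = diag_mx (\row_x v 0 ((enum_val x : config n d) k)).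
Proof.
apply/matrixP => x y; rewrite !mxE (bigD1 k) //= eqxx !mxE.
have [<-|neq_xy] := eqVneq x y.
  by rewrite eqxx big1 ?mulr1 // => l /negPf ->; rewrite mxE eqxx.
have [l neq_l] := config_neq _ _ _ _ neq_xy.
have [lk|neq_lk] := eqVneq l k; first by rewrite -lk (negPf neq_l) mul0r.
by rewrite (bigD1 l) //= (negPf neq_lk) mxE (negPf neq_l) mul0r mulr0.
Qed.

Lemma phase_unitaryE (t : 'I_n -> R) :
  phase_unitary d t = tensor (fun k => phase_mx (t k)).
Proof.
rewrite -prod_on_node; apply: eq_bigr => k _.
rewrite !on_node_diag.
rewrite (_ : \row_x _ = \row_x (((enum_val x : config n d) k)%:R : R)%:C); last first.
  by apply/rowP => x; rewrite !mxE rmorph_nat.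
rewrite expmx_diag; congr diag_mx; apply/rowP => x.
by rewrite !mxE.
Qed.

Lemma conj_phase_unitary (c : 'M[R]_n) (t : 'I_n -> R) :
  let W := phase_unitary d t in
  W *m coupling_hamiltonian d c *m W^t* =
  \sum_k \sum_l ((c k l)%:C * ((expi (t k))^*%R * expi (t l))) *:
     (on_node k a *m (on_node l a)^t*).
Proof.
move=> W; rewrite /W phase_unitaryE.
(* The scheme puts the adjoint on the right of [H], the conjugation lemma on the left; hence the
   lemma is applied to the adjoint phases. *)
have /(conj_coupling_hamiltonian c _) : forall k, (phase_mx (t k))^t* \is unitarymx.
  by move=> k; rewrite trmxC_unitary phase_mx_unitary.
rewrite -tensor_adj trmxCK => ->.
apply: eq_bigr => k _; apply: eq_bigr => l _.
rewrite !trmxCK !phase_mx_conj_annihilation !on_nodeZ -scalemxAl !linearZ /=.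
rewrite map_mxZ -scalemxAr !scalerA /= !conj_expi opprK.
by rewrite mulrA [_ * (c k l)%:C]mulrC.
Qed.

Lemma expi_fourier_angle j (k : 'I_n) :
  expi (fourier_angle R j k) = expi (2 * pi * k.+1%:R / n%:R) ^+ j.
Proof. by rewrite -expiMn; congr expi; rewrite /fourier_angle natrM -mulr_natr; ring. Qed.

(** The summands are the powers 1 to [n.-1] of an [n]-th root of unity [w] other than 1. All [n]
    powers sum to zero, and the missing zeroth one is 1. *)
Lemma fourier_orthogonal (k l : 'I_n) : k != l ->
  \sum_(j < n.-1) (expi (fourier_angle R j.+1 k))^*%R * expi (fourier_angle R j.+1 l) = -1.
Proof.
move=> neq_kl; have n_gt0 : (0 < n)%N by apply: leq_trans (ltn_ord k).
have nR_gt0 : 0 < n%:R :> R by rewrite ltr0n.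
pose z (m : 'I_n) : R[i] := expi (2 * pi * m.+1%:R / n%:R).
have zX m : z m ^+ n = 1.
  rewrite -expiMn -[_ *+ n]mulr_natr divfK ?gt_eqF // mulr_natr expiMn expi_2pi.
  exact: expr1n.
pose w := (z k)^*%R * z l.
have wX : w ^+ n = 1 by rewrite exprMn -rmorphXn /= !zX rmorph1 mulr1.
(* For [p < q] the angle of this quotient is [2 * pi * (q - p) / n], strictly between 0 and a full
   turn. The case [l < k] below follows by conjugation. *)
have zneq (p q : 'I_n) : (p < q)%N -> (z p)^*%R * z q != 1.
  move=> lt_pq; rewrite conj_expi -expiD addrC -mulrBl -mulrBr.
  apply: expi_neq1; rewrite -natrB ?ltnS ?(ltnW lt_pq) // subSS.
  rewrite divr_gt0 ?mulr_gt0 ?pi_gt0 ?ltr0n ?subn_gt0 //=.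
  rewrite ltr_pdivrMr // ltr_pM2l ?mulr_gt0 ?pi_gt0 // ltr_nat.
  by rewrite (leq_ltn_trans (leq_subr _ _)).
have w_neq1 : w != 1.
  move: neq_kl; rewrite neq_ltn => /orP[/zneq //|/zneq].
  apply: contra => /eqP w1; apply/eqP.
  by rewrite -[RHS](rmorph1 Num.conj) -w1 rmorphM /= conjCK mulrC.
have : (w - 1) * \sum_(j < n) w ^+ j = 0 by rewrite -subrX1 wX subrr.
move/eqP; rewrite mulf_eq0 subr_eq0 (negPf w_neq1) /=.
have -> : \sum_(j < n) w ^+ j = 1 + \sum_(j < n.-1) w ^+ j.+1.
  rewrite -(big_mkord xpredT (fun j => w ^+ j)) big_ltn // expr0.
  by rewrite big_add1 big_mkord.
rewrite addrC addr_eq0 => /eqP <-.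
by apply: eq_bigr => j _; rewrite !expi_fourier_angle exprMn rmorphXn.
Qed.

Lemma inverting_scheme_fourier (c : 'M[R]_n) : (forall k, c k k = 0) ->
  inverting_scheme (coupling_hamiltonian d c) (@fourier_scheme R n).
Proof.
move=> c_diag; split=> [k j|W stepW]; first by rewrite mxE norm_expi.
have WE j : W j *m coupling_hamiltonian d c *m (W j)^t* =
  \sum_k \sum_l ((c k l)%:C * ((expi (fourier_angle R j.+1 k))^*%R *
     expi (fourier_angle R j.+1 l))) *: (on_node k a *m (on_node l a)^t*).
  (* The angles [t] may differ from the Fourier angles, but the conjugated Hamiltonian depends only
     on the values [expi (t k)]. *)
  have [t tE ->] := stepW j; rewrite conj_phase_unitary.
  by apply: eq_bigr => k _; apply: eq_bigr => l _; rewrite -!tE !mxE.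
rewrite (eq_bigr _ (fun j _ => WE j)) exchange_big -sumrN; apply: eq_bigr => k _ /=.
rewrite exchange_big -sumrN; apply: eq_bigr => l _ /=.
rewrite -scaler_suml -mulr_sumr -scaleNr; congr (_ *: _).
(* For [k = l] the phases would add up to [n.-1] and not to -1; the zero diagonal of [c] removes
   these terms. *)
have [->|neq_kl] := eqVneq k l; first by rewrite c_diag mul0r oppr0.
by rewrite fourier_orthogonal // mulrN1.
Qed.

End Scheme.

Arguments coupling_conj {R n d}.

(** * The lower bound on the overhead *)

Section LowerBound.
Variables (R : realType) (n d : nat).
Local Notation a := (annihilation R d).
Local Notation C := R[i].

Lemma mxtrace_annihilation : \tr a = 0.
Proof. by apply: big1 => E _; rewrite mxE ltn_eqF. Qed.

Lemma mxtrace_annihilation_sqr : \tr (a *m a) = 0.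
Proof.
apply: big1 => E _; rewrite mxE; apply: big1 => F _; rewrite !mxE.
case: eqP => [->|_]; last by rewrite mul0r.
by rewrite ltn_eqF ?mulr0 // ltnS leqnSn.
Qed.

Lemma mxtrace_adj_annihilation_gt0 : (1 < d)%N -> 0 < \tr (a^t* *m a).
Proof.
move=> d_gt1; rewrite lt_def mxtrace_adjM_ge0 andbT.
apply/eqP => /eqP; rewrite psumr_eq0; last first.
  by move=> i _; rewrite mxE sumr_ge0 // => j _; rewrite !mxE /= mulrC mul_conjC_ge0.
(* The entry of [a] in row 0 and column 1 is 1, so it contradicts a vanishing sum of squares. *)
move=> /allP/(_ (Ordinal d_gt1))/(_ (mem_index_enum _)) /=.
rewrite mxE psumr_eq0; last by move=> j _; rewrite !mxE /= mulrC mul_conjC_ge0.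
move=> /allP/(_ (Ordinal (ltnW d_gt1)))/(_ (mem_index_enum _)) /=.
by rewrite !mxE /= mulrC mul_conjC_eq0 sqrtr1 oner_eq0.
Qed.

(** The trace factors over the nodes. If [p] or [q] lies outside [k] and [l], that node contributes
    a vanishing trace; otherwise the [n - 2] remaining nodes contribute [d] each. *)
Lemma mxtrace_node_pairs (k l p q : 'I_n) (X Y A B : 'M[C]_d) :
    k != l -> p != q -> \tr A = 0 -> \tr B = 0 ->
  \tr (on_node k X *m on_node l Y *m (on_node p A *m on_node q B)) =
  d%:R ^+ #|[set~ k] :\ l| *
    (if (p == k) && (q == l) then \tr (X *m A) * \tr (Y *m B)
     else if (p == l) && (q == k) then \tr (X *m B) * \tr (Y *m A) else 0).
Proof.
move=> kl pq A0 B0; rewrite !tensorM mxtrace_tensor.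
have lk : l != k by rewrite eq_sym.
have qp : q != p by rewrite eq_sym.
have [pk|pNk] /= := eqVneq p k; have [pl|pNl] /= := eqVneq p l.
- by case/eqP: kl; rewrite -pk -pl.
- have [ql|qNl] := eqVneq q l; last first.
    rewrite (bigD1 q) //= (negPf qp) eqxx (negPf qNl) -pk (negPf qp).
    by rewrite !mul1mx B0 mul0r mulr0.
  subst p q; rewrite (bigD1 k) //= (bigD1 l) //= !eqxx (negPf kl) (negPf lk).
  rewrite !(mul1mx, mulmx1) mulrA mulrC; congr (_ * _).
  rewrite (eq_bigr (fun=> d%:R)); last first.
    by move=> r /andP[/negPf -> /negPf ->]; rewrite !mul1mx mxtrace1.
  by rewrite prodr_const; congr (_ ^+ _); apply: eq_card => r; rewrite !inE andbC.
- have [qk|qNk] := eqVneq q k; last first.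
    rewrite (bigD1 q) //= (negPf qp) eqxx (negPf qNk) -pl (negPf qp).
    by rewrite !mul1mx B0 mul0r mulr0.
  subst p q; rewrite (bigD1 k) //= (bigD1 l) //= !eqxx (negPf kl) (negPf lk).
  rewrite !(mul1mx, mulmx1) mulrA mulrC; congr (_ * _).
  rewrite (eq_bigr (fun=> d%:R)); last first.
    by move=> r /andP[/negPf -> /negPf ->]; rewrite !mul1mx mxtrace1.
  by rewrite prodr_const; congr (_ ^+ _); apply: eq_card => r; rewrite !inE andbC.
- rewrite (bigD1 p) //= eqxx (negPf pq) (negPf pNk) (negPf pNl).
  by rewrite !mul1mx mulmx1 A0 mul0r mulr0.
Qed.

(** Probing nodes [k] and [l] leaves only the terms of index [(k, l)] and [(l, k)], which share one
    coefficient by the symmetry of [c]. *)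
Lemma mxtrace_coupling_conj (c : 'M[R]_n) (A : 'I_n -> 'M[C]_d) (k l : 'I_n)
    (X Y : 'M[C]_d) :
    c^T = c -> (forall p, c p p = 0) -> (forall p, \tr (A p) = 0) -> k != l ->
  \tr (on_node k X *m on_node l Y *m coupling_conj c A) =
  d%:R ^+ #|[set~ k] :\ l| * (c k l)%:C *
    (\tr (X *m A k) * \tr (Y *m (A l)^t*) + \tr (X *m (A k)^t*) * \tr (Y *m A l)).
Proof.
move=> c_sym c_diag A0 kl; set D := d%:R ^+ _.
have A0' p : \tr ((A p)^t*) = 0 by rewrite mxtrace_adj A0 conjC0.
have lk : l != k by rewrite eq_sym.
rewrite /coupling_conj pair_big /= mulmx_sumr raddf_sum /=.
under eq_bigr do rewrite -scalemxAr linearZ /= on_node_adj.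
rewrite (bigD1 (k, l)) //= mxtrace_node_pairs // !eqxx /= -/D.
rewrite (bigD1 (l, k)) /=; last by rewrite xpair_eqE (negPf lk).
rewrite mxtrace_node_pairs // !eqxx (negPf lk) /= -/D.
rewrite big1 ?addr0 => [|[p q] /=]; last first.
  rewrite !xpair_eqE => /andP[pq_kl pq_lk].
  have [->|pq] := eqVneq p q; first by rewrite c_diag mul0r.
  by rewrite mxtrace_node_pairs // (negPf pq_kl) (negPf pq_lk) !mulr0.
have -> : c l k = c k l by rewrite -{1}c_sym mxE.
ring.
Qed.

Lemma overhead_ge (c : 'M[R]_n) s (tau : 'I_s -> R) (V : 'I_s -> 'I_n -> 'M[C]_d) :
    (1 < n)%N -> (1 < d)%N -> c^T = c -> (forall k, c k k = 0) ->
    (forall k l, k != l -> c k l != 0) ->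
    inverting_simulation (coupling_hamiltonian d c) tau V ->
  n.-1%:R <= \sum_j tau j.
Proof.
move=> n_gt1 d_gt1 c_sym c_diag c_neq0 [tau_gt0 uV invH].
pose A j k := (V j k)^t* *m a *m V j k.
pose N := \tr (a^t* *m a); have N_gt0 : 0 < N := mxtrace_adj_annihilation_gt0 d_gt1.
pose x j k := \tr (a^t* *m A j k); pose y j k := \tr (a *m A j k).
have VVC j k : V j k *m (V j k)^t* = 1%:M by apply/unitarymxP.
have A0 j k : \tr (A j k) = 0.
  by rewrite mxtrace_mulC mulmxA VVC mul1mx mxtrace_annihilation.
have trA j k : \tr ((A j k)^t* *m A j k) = N.
  rewrite /A !adjmxM trmxCK !mulmxA -[_ *m V j k *m _]mulmxA VVC mulmx1.
  by rewrite mxtrace_mulC !mulmxA VVC mul1mx.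
have bessel j k : `|x j k| ^+ 2 + `|y j k| ^+ 2 <= N ^+ 2.
  by apply: bessel_adj_pair => //; exact: mxtrace_annihilation_sqr.
have pairE k l : k != l ->
    \sum_j (tau j)%:C * (x j k * (x j l)^*%R + (y j k)^*%R * y j l) = - N ^+ 2.
  move=> kl; pose D : C := d%:R ^+ #|[set~ k] :\ l| * (c k l)%:C.
  have D_neq0 : D != 0.
    rewrite mulf_neq0 ?expf_neq0 ?pnatr_eq0 -?lt0n ?(ltnW d_gt1) //.
    by rewrite fmorph_eq0 c_neq0.
  (* The left factor is the adjoint of [a_k a_l^*]. For the Hamiltonian itself the second product of
     traces vanishes with [\tr (a *m a)]. *)
  have HE : \tr (on_node k (a^t*) *m on_node l a *m coupling_hamiltonian d c) = D * N ^+ 2.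
    rewrite (mxtrace_coupling_conj c (fun=> a)) //; last by move=> _; exact: mxtrace_annihilation.
    by rewrite mxtrace_annihilation_sqr mulr0 addr0 [\tr (a *m a^t*)]mxtrace_mulC expr2.
  apply: (mulfI D_neq0); rewrite mulrN -HE -raddfN -mulmxN invH mulmx_sumr raddf_sum mulr_sumr.
  apply: eq_bigr => j _ /=; rewrite conj_coupling_hamiltonian // -scalemxAr linearZ /=.
  rewrite mxtrace_coupling_conj //; last exact: A0.
  rewrite -/D -/(A j k) -/(A j l) -/(x j k) -/(y j l).
  have -> : \tr (a *m (A j l)^t*) = (x j l)^*%R.
    by rewrite conj_mxtrace_mul trmxCK.
  have -> : \tr (a^t* *m (A j k)^t*) = (y j k)^*%R.
    by rewrite conj_mxtrace_mul.
  by rewrite mulrCA.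
pose S j := \sum_k \sum_(l | k != l) (x j k * (x j l)^*%R + (y j k)^*%R * y j l).
have S_ge j : - (n%:R * N ^+ 2) <= S j by exact: sum_offdiag_ge.
(* Each of the [n * n.-1] ordered pairs of distinct nodes contributes the same value by [pairE]. *)
have SE : \sum_j (tau j)%:C * S j = - (n%:R * n.-1%:R * N ^+ 2).
  under eq_bigr do rewrite mulr_sumr.
  rewrite exchange_big /= (eq_bigr (fun=> - (n.-1%:R * N ^+ 2))) => [|k _].
    by rewrite sumr_const card_ord -[LHS]mulr_natl mulrN mulrA.
  under eq_bigr do rewrite mulr_sumr.
  rewrite exchange_big /= (eq_bigr (fun=> - N ^+ 2)) => [|l /pairE //].
  rewrite sumr_const -[LHS]mulr_natl mulrN; congr (- (_%:R * _)).
  rewrite -[n in RHS]card_ord -(cardC1 k).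
  by apply: eq_card => l; rewrite !inE eq_sym.
(* The bounds on the [S j] are weighted by the positive [tau j]. The comparison takes place in
   [R[i]]; the positive factor [n%:R * N ^+ 2] is cancelled before returning to [R]. *)
have : - (n%:R * N ^+ 2) * (\sum_j tau j)%:C <= - (n%:R * n.-1%:R * N ^+ 2).
  rewrite -SE rmorph_sum mulr_sumr; apply: ler_sum => j _.
  by rewrite mulrC ler_wpM2l // ler0c ltW.
rewrite mulNr lerN2 mulrAC ler_pM2l; last by rewrite mulr_gt0 ?exprn_gt0 // ltr0n ltnW.
by rewrite -(rmorph_nat (real_complex R)) lecR.
Qed.

End LowerBound.

Theorem theorem5 (R : realType) (n d : nat) (hn : (2 <= n)%N) (hd : (2 <= d)%N)
    (c : 'M[R]_n) (c_sym : c^T = c) (c_diag : forall k, c k k = 0)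
    (c_offdiag : forall k l, k != l -> c k l != 0) :
  let H := coupling_hamiltonian d c in
  [/\ time_optimal_inverting_scheme H (@fourier_scheme R n),
      \sum_(1 <= j < n)
         phase_unitary d (@fourier_angle R n j) *m H
           *m (phase_unitary d (@fourier_angle R n j))^t* = - H
    & forall (s : nat) (tau : 'I_s -> R) (V : 'I_s -> 'I_n -> 'M[R[i]]_d),
        (forall j, 0 < tau j) ->
        (forall j k, V j k \is unitarymx /\ \det (V j k) = 1) ->
        - H = \sum_(j < s)
                (tau j)%:C *: ((tensor (V j))^t* *m H *m tensor (V j)) ->
        (n.-1)%:R <= \sum_(j < s) tau j].
Proof.
move=> H; have invF : inverting_scheme H (@fourier_scheme R n).
  exact: inverting_scheme_fourier.
split.
- by split=> // s tau V; exact: overhead_ge.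
(* The Fourier angles are themselves an admissible choice; the ordinal [j] stands for step [j.+1],
   whence the shift of the sum. *)
- rewrite -(invF.2 (fun j => phase_unitary d (@fourier_angle R n j.+1))); last first.
    by move=> j; exists (@fourier_angle R n j.+1) => // k; rewrite mxE.
  by rewrite big_add1 big_mkord.
- move=> s tau V tau_gt0 uV invH; apply: (overhead_ge _ _ _ c s tau V) => //; split=> // j k.
  by have [] := uV j k.
Qed.
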